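(* Let $p$ be a prime, let $G_n$ be a multigraph with vertices $v_1,\dots,v_n$ and adjacency matrix $\Gamma$, and let $\Lambda=[I_n\,|\,\Gamma]$ be the $n\times 2n$ matrix over $\mathbb{Z}/p\mathbb{Z}$. Then the diagonal distance of $G_n$ over $\mathbb{Z}/p\mathbb{Z}$ satisfies $$\Delta(G_n)=\min\left\{\sum_{i=1}^n \chi(k_i)>0 \;\middle|\; k\in(\mathbb{Z}/p\mathbb{Z})^{2n},\ \Lambda k=0 \pmod p\right\}.$$
   Context: $G_n$ is an undirected multigraph (multiple edges between vertices allowed) with vertex set $\{v_1,\dots,v_n\}$; its adjacency matrix $\Gamma$ is the $n\times n$ matrix with $\Gamma_{ij}$ equal to the number of edges between $v_i$ and $v_j$ (taken mod $p$), and $\Gamma_{ij}=0$ if there is no such edge. A labelling is an element $L=(L_1,\dots,L_n)\in(\mathbb{Z}/p\mathbb{Z})^n$. For each $i$ define maps $(\mathbb{Z}/p\mathbb{Z})^n\to(\mathbb{Z}/p\mathbb{Z})^n$: $Z_i$ replaces $L_i$ by $L_i+1\bmod p$, leaving other entries unchanged; $X_i$ replaces each $L_j$ by $L_j+\Gamma_{ij}\bmod p$ for all $1\le j\le n$. Let $\langle Z_i,X_i\rangle$ be the group of maps generated by $Z_i,X_i$ under composition and $I$ the identity map. For $O_i\in\langle Z_i,X_i\rangle$, $\eta(O_i)=1$ if $O_i\ne I$ and $\eta(O_i)=0$ if $O_i=I$. The diagonal distance is $$\Delta(G_n)=\min\left\{\sum_{i=1}^n\eta(O_i)>0 \;\middle|\;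 \prod_{i=1}^n O_i=I,\ O_i\in\langle Z_i,X_i\rangle,\ 1\le i\le n\right\},$$ with $\prod$ denoting composition. For $k=(k_1,\dots,k_{2n})$ and $1\le i\le n$, $\chi(k_i)=1$ if $k_i\ne0$ or $k_{i+n}\ne0$, and $\chi(k_i)=0$ otherwise. $I_n$ is the $n\times n$ identity matrix.
   Formalization: Adds that n ≥ 1 and every vertex is joined to some other vertex by a number of edges not divisible by p; otherwise the formula fails (with n = 3 and a single edge v_1v_2, Δ = 2 but the right side is 1). *)

(* Defs.v *)
From mathcomp Require Import all_boot all_fingroup all_algebra.

Set Implicit Arguments.
Unset Strict Implicit.
Unset Printing Implicit Defensive.

Import GRing.Theory.
Local Open Scope ring_scope.

(* Only the number of edges between two vertices is recorded; loops are not
   excluded, and [mult i i] is the number of loops at [i]. *)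
Record multigraph (n : nat) := Multigraph {
  mult : 'I_n -> 'I_n -> nat;
  mult_sym : forall i j, mult i j = mult j i }.

(* For [p] prime, ['F_p] is the ring of integers modulo [p]. *)
Definition adjacency (p n : nat) (G : multigraph n) : 'M['F_p]_n :=
  \matrix_(i, j) (mult G i j)%:R.

Definition labelling (p n : nat) : finType := 'rV['F_p]_n.

Definition Zfun (p n : nat) (i : 'I_n) (L : labelling p n) : labelling p n :=
  \row_j (if j == i then L 0 j + 1 else L 0 j).

Definition Xfun (p n : nat) (G : multigraph n) (i : 'I_n)
    (L : labelling p n) : labelling p n :=
  \row_j (L 0 j + adjacency p G i j).

Lemma Zfun_inj (p n : nat) (i : 'I_n) : injective (@Zfun p n i).
Proof.
move=> L L' /rowP eqL; apply/rowP => j; move: (eqL j); rewrite !mxE.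
by case: eqP => // _ /addIr.
Qed.

Lemma Xfun_inj (p n : nat) (G : multigraph n) (i : 'I_n) :
  injective (@Xfun p n G i).
Proof.
move=> L L' /rowP eqL; apply/rowP => j; move: (eqL j); rewrite !mxE.
exact: addIr.
Qed.

Definition Zop (p n : nat) (i : 'I_n) : {perm labelling p n} :=
  perm (@Zfun_inj p n i).

Definition Xop (p n : nat) (G : multigraph n) (i : 'I_n) :
    {perm labelling p n} :=
  perm (@Xfun_inj p n G i).

Definition local_group (p n : nat) (G : multigraph n) (i : 'I_n) :
    {group {perm labelling p n}} :=
  <<[set Zop p i; Xop p G i]>>%G.

Definition eta (p n : nat) (O : {perm labelling p n}) : nat := (O != 1%g).

Definition chi (p n : nat) (k : 'cV['F_p]_(n + n)) (i : 'I_n) : nat :=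
  (k (lshift n i) 0 != 0) || (k (rshift n i) 0 != 0).

Definition is_min (S : nat -> Prop) (d : nat) : Prop :=
  S d /\ (forall m : nat, S m -> (d <= m)%N).

(* A relation rather than a function: the minimum is over a set that may be
   empty, e.g. for a graph without edges. *)
Definition is_diagonal_distance (p n : nat) (G : multigraph n) (d : nat) :
    Prop :=
  is_min (fun m => (0 < m)%N /\
    exists O : 'I_n -> {perm labelling p n},
      [/\ forall i, O i \in local_group p G i,
          (\prod_(i < n) O i)%g = 1%g
        & m = (\sum_(i < n) eta (O i))%N]) d.

Definition Lambda (p n : nat) (G : multigraph n) : 'M['F_p]_(n, n + n) :=
  row_mx 1%:M (adjacency p G).

(* Loops are ignored and the other edges are counted modulo [p].  At a vertex
   [i] violating this, some [X_i Z_i^a] is the identity map, so [eta] is 0 on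
   it, while the corresponding [k] satisfies [Lambda *m k = 0] and has exactly
   one nonzero [chi k i]. *)
Definition no_isolated_vertex (p n : nat) (G : multigraph n) : Prop :=
  forall i : 'I_n, exists2 j : 'I_n, j != i & adjacency p G i j != 0.

(* Main.v *)
Require Import Defs.
From mathcomp Require Import all_boot all_fingroup all_algebra.
Import GRing.Theory.
Local Open Scope ring_scope.

(* Z_i and X_i translate labellings by the i-th basis vector e_i and by the
   i-th row G_i of the adjacency matrix, so <Z_i, X_i> consists of the
   translations by a e_i + b G_i.  Reading (a, b) as (k_i, k_(n+i)), the product
   of the chosen operators is the translation by (Lambda k)^T, and since G_i has
   a nonzero entry off the diagonal, a e_i + b G_i = 0 only if a = b = 0. *)

Section Translations.
Variables (p n : nat).
Implicit Types (v w : 'rV['F_p]_n).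

(** The cast recovers the additive structure, which [labelling], declared as a [finType], hides. *)
Definition shift v (L : labelling p n) : labelling p n := (L : 'rV['F_p]_n) + v.

Lemma shift_inj v : injective (shift v).
Proof. by move=> L L' /addIr. Qed.

Definition translation v : {perm labelling p n} := perm (@shift_inj v).

Lemma translation0 : translation 0 = 1%g.
Proof. by apply/permP=> L; rewrite permE perm1 /shift addr0. Qed.

Lemma translationD v w :
  translation (v + w) = (translation v * translation w)%g.
Proof. by apply/permP=> L; rewrite permM !permE /shift addrA. Qed.

Lemma translationMn v m : translation (v *+ m) = (translation v ^+ m)%g.
Proof.
elim: m => [|m IHm]; first by rewrite mulr0n translation0 expg0.
by rewrite mulrS translationD IHm expgS.
Qed.

Lemma translation_sum (I : Type) (r : seq I) (v : I -> 'rV['F_p]_n) :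
  translation (\sum_(i <- r) v i) = (\prod_(i <- r) translation (v i))%g.
Proof.
elim: r => [|i r IHr]; first by rewrite !big_nil translation0.
by rewrite !big_cons translationD IHr.
Qed.

Lemma translation_eq1 v : (translation v == 1%g) = (v == 0).
Proof.
(* The image of the zero labelling is [v] itself. *)
apply/eqP/eqP=> [/permP/(_ (0 : 'rV['F_p]_n))|->]; last exact: translation0.
by rewrite permE perm1 /shift add0r.
Qed.

End Translations.

Arguments translation {p n}.

Section LocalOperators.
Variables (p n : nat) (G : multigraph n).
Implicit Types (i j : 'I_n) (a b : 'F_p) (k : 'cV['F_p]_(n + n)).

Definition local_vector i a b : 'rV['F_p]_n :=
  a *: delta_mx 0 i + b *: row i (adjacency p G).

Lemma Zop_translation i : Zop p i = translation (delta_mx 0 i).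
Proof.
apply/permP=> L; rewrite !permE; apply/rowP=> j.
by rewrite !mxE /=; case: eqP => //; rewrite addr0.
Qed.

Lemma Xop_translation i : Xop p G i = translation (row i (adjacency p G)).
Proof. by apply/permP=> L; rewrite !permE; apply/rowP=> j; rewrite !mxE. Qed.

Lemma translation_local i a b :
  translation (local_vector i a b) = (Zop p i ^+ a * Xop p G i ^+ b)%g.
Proof.
rewrite Zop_translation Xop_translation -!translationMn -translationD.
(* The exponents are the natural representatives of [a] and [b]; cast back to ['F_p] they are [a]
   and [b] again. *)
by rewrite -!scaler_nat !natr_Zp.
Qed.

Lemma local_groupP i (O : {perm labelling p n}) :
  reflect (exists a b, O = translation (local_vector i a b))
          (O \in local_group p G i).
Proof.
apply: (iffP idP) => [|[a [b ->]]]; last first.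
  by rewrite translation_local groupM // groupX // mem_gen // !inE eqxx ?orbT.
(* For the forward direction, [H] contains both generators; being finite, it is a group once it
   contains 1 and is closed under products. *)
pose H := [set translation (local_vector i x.1 x.2) | x : 'F_p * 'F_p].
have gH : group_set H.
  apply/group_setP; split=> [|_ _ /imsetP[x _ ->] /imsetP[y _ ->]].
    apply/imsetP; exists (0, 0) => //=.
    by rewrite /local_vector !scale0r addr0 translation0.
  apply/imsetP; exists (x.1 + y.1, x.2 + y.2) => //=.
  by rewrite -translationD /local_vector !scalerDl addrACA.
have sH : local_group p G i \subset Group gH.
  rewrite gen_subG; apply/subsetP=> x; rewrite !inE => /orP[]/eqP->.
    apply/imsetP; exists (1, 0) => //=.
    by rewrite /local_vector scale1r scale0r addr0 Zop_translation.
  apply/imsetP; exists (0, 1) => //=.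
  by rewrite /local_vector scale1r scale0r add0r Xop_translation.
by move/(subsetP sH)=> /imsetP[[a b] _ ->]; exists a, b.
Qed.

Lemma local_vector_eq0 i a b : no_isolated_vertex p G ->
  (local_vector i a b == 0) = (a == 0) && (b == 0).
Proof.
move=> /(_ i)[j nij Gij]; apply/eqP/andP=> [v0|[/eqP-> /eqP->]]; last first.
  by rewrite /local_vector !scale0r addr0.
have b0 : b = 0.
  (* At the neighbour [j] of [i] the basis vector vanishes, leaving [b] times a nonzero entry. *)
  move/rowP/(_ j): v0; rewrite /local_vector mxE mxE mxE [X in _ + X]mxE.
  rewrite [row _ _ _ _]mxE [RHS]mxE (negPf nij) mulr0 add0r => /eqP.
  by rewrite mulf_eq0 (negPf Gij) orbF => /eqP.
split; last exact/eqP.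
(* With [b = 0], loops at [i] contribute nothing, so coordinate [i] reads [a]. *)
by move/rowP/(_ i): v0; rewrite b0 !mxE !eqxx mul0r mulr1 addr0 => ->.
Qed.

(** Reconciles [Xop], which adds rows of the adjacency matrix, with [Lambda p G *m k], which
    combines its columns. *)
Lemma adjacency_tr : (adjacency p G)^T = adjacency p G.
Proof. by apply/matrixP=> i j; rewrite !mxE mult_sym. Qed.

Definition local_operators k i : {perm labelling p n} :=
  translation (local_vector i (k (lshift n i) 0) (k (rshift n i) 0)).

Lemma sum_local_vector k :
  \sum_i local_vector i (k (lshift n i) 0) (k (rshift n i) 0)
    = (Lambda p G *m k)^T.
Proof.
rewrite -[k in RHS]vsubmxK mul_row_col mul1mx linearD /= trmx_mul adjacency_tr.
(* The upper half of [k] is expanded in the standard basis; the lower half gives the coefficients of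
   the rows of the adjacency matrix. *)
rewrite big_split /= (row_sum_delta (usubmx k)^T) mulmx_sum_row.
by congr (_ + _); apply: eq_bigr => i _; rewrite !mxE.
Qed.

Lemma prod_local_operators k :
  (\prod_i local_operators k i == 1)%g = (Lambda p G *m k == 0).
Proof.
rewrite -translation_sum translation_eq1 sum_local_vector.
by rewrite -[RHS](inj_eq trmx_inj) trmx0.
Qed.

Lemma eta_local_operators k i : no_isolated_vertex p G ->
  eta (local_operators k i) = chi k i.
Proof.
by move=> hG; rewrite /eta translation_eq1 local_vector_eq0 // negb_and.
Qed.

Lemma local_operatorsP (O : 'I_n -> {perm labelling p n}) :
  (forall i, O i \in local_group p G i) <-> exists k, O =1 local_operators k.
Proof.
split=> [memO|[k eqO] i]; last first.
  by rewrite eqO; apply/local_groupP; do 2!eexists.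
(* Coefficients are chosen at all vertices at once, then stacked into one column. *)
have /fin_all_exists[a /fin_all_exists[b Oab]] i :
  exists a b, O i = translation (local_vector i a b) by apply/local_groupP.
exists (col_mx (\col_i a i) (\col_i b i)) => i.
by rewrite Oab /local_operators col_mxEu col_mxEd !mxE.
Qed.

(** Boolean, since [k] ranges over a finite type, so that [ex_minnP] can extract a least weight. *)
Definition kernel_weight m : bool :=
  (0 < m)%N && [exists k, (Lambda p G *m k == 0) && (m == \sum_i chi k i)%N].

Lemma kernel_weightP m :
  reflect ((0 < m)%N /\ exists k, Lambda p G *m k = 0 /\ m = (\sum_i chi k i)%N)
          (kernel_weight m).
Proof.
apply: (iffP andP) => -[m0].
  by case/existsP=> k /andP[/eqP k0 /eqP Em]; split=> //; exists k.
by case=> k [k0 Em]; split=> //; apply/existsP; exists k; rewrite k0 -Em !eqxx.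
Qed.

Lemma kernel_weight_ex : (0 < n)%N -> exists m, kernel_weight m.
Proof.
move=> n_gt0; pose i0 := Ordinal n_gt0.
pose x : 'cV['F_p]_n := delta_mx i0 0.
(* The identity block of [Lambda] lets the upper half cancel any lower half [x]; a nonzero [x] makes
   the weight positive. *)
pose k := col_mx (- (adjacency p G *m x)) x.
exists (\sum_i chi k i)%N; apply/kernel_weightP; split; last first.
  by exists k; rewrite mul_row_col mul1mx addNr.
by rewrite (bigD1 i0) //= /chi col_mxEd !mxE !eqxx oner_eq0 orbT.
Qed.

End LocalOperators.

Arguments local_operators {p n}.

Theorem theorem2 (p n : nat) (p_prime : prime p) (n_gt0 : (0 < n)%N)
    (G : multigraph n) (G_no_isolated : no_isolated_vertex p G) :
  exists d : nat,
    is_diagonal_distance p G d /\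
    is_min (fun m => (0 < m)%N /\
      exists k : 'cV['F_p]_(n + n),
        Lambda p G *m k = 0 /\ m = (\sum_(i < n) chi k i)%N) d.
Proof.
case: (ex_minnP (kernel_weight_ex p n G n_gt0)) => d.
move=> /kernel_weightP[d0 [k [k0 dk]]] d_min; exists d; split; split.
- split=> //; exists (local_operators G k); split.
  + by apply/local_operatorsP; exists k.
  + by apply/eqP; rewrite prod_local_operators k0.
  + by rewrite dk; apply: eq_bigr => i _; rewrite eta_local_operators.
- move=> m [m0 [O [/local_operatorsP[k' eqO] prodO Em]]].
  (* The coefficients [k'] of [O] form a kernel vector of the same weight [m], so minimality of [d]
     over the kernel applies. *)
  apply/d_min/kernel_weightP; split=> //; exists k'; split.
    apply/eqP; rewrite -prod_local_operators -(eq_bigr _ (fun i _ => eqO i)).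
    by rewrite prodO.
  by rewrite Em; apply: eq_bigr => i _; rewrite eqO eta_local_operators.
- by split=> //; exists k.
- by move=> m /kernel_weightP /d_min.
Qed.
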